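(* Let $d\ge1$, $N\ge0$ be integers and $\rho\in(0,1)^d$ with $|\rho|<1$. For $\alpha\in\mathbb N_0^{d+1}$ with $|\alpha|\le N$ and $x\in\mathbb Z_N^{d+1}$, $$\mathsf L_\alpha(x;\rho,N)=(-N)_{|\alpha|}\,\boldsymbol\rho^\alpha\sum_{\gamma\le\alpha}\frac{(-\alpha)_\gamma(-1)^{|\gamma|}}{\gamma!\,(-N)_{|\gamma|}\,\boldsymbol\rho^\gamma}\,\mathrm m_\gamma(x).$$ Conversely, $$\mathrm m_\alpha(x)=(-1)^{|\alpha|}(-N)_{|\alpha|}\,\boldsymbol\rho^\alpha\sum_{\beta\le\alpha}\frac{(-\alpha)_\beta}{\beta!\,(-N)_{|\beta|}\,\boldsymbol\rho^\beta}\,\mathsf L_\beta(x;\rho,N).$$ The sums are over multi-indices in $\mathbb N_0^{d+1}$ that are componentwise at most $\alpha$.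
   Context: Notation: $(a)_n=a(a+1)\cdots(a+n-1)$, $(a)_0=1$; for vectors, $|y|$ is the sum of the components, $\alpha!=\prod_i\alpha_i!$, $y^\alpha=\prod_iy_i^{\alpha_i}$, $(y)_\alpha=\prod_i(y_i)_{\alpha_i}$. $\mathbb Z_N^{d+1}=\{\alpha\in\mathbb N_0^{d+1}:|\alpha|=N\}$, $\boldsymbol\rho=(\rho,1-|\rho|)\in\mathbb R^{d+1}$. Inner product: $\langle f,g\rangle_{\mathsf K_{\rho,N}}=N!\sum_{x\in\mathbb Z_N^{d+1}}f(x)g(x)\frac{\boldsymbol\rho^x}{x!}$. $\Pi_n^d$ is the space of polynomials of total degree at most $n$ in $x_1,\dots,x_d$ ($\Pi_{-1}^d=\{0\}$), regarded as functions on $\mathbb Z_N^{d+1}$ (where $x_{d+1}=N-x_1-\cdots-x_d$); polynomials in $x_1,\dots,x_{d+1}$ are regarded as functions on $\mathbb Z_N^{d+1}$ in the same way. For $0\le n\le N$, $\mathcal V_n^d(\mathsf K_{\rho,N})$ is the space of $p\in\Pi_n^d$ orthogonal to $\Pi_{n-1}^d$. Let $\mathrm m_\alpha(x)=(-1)^{|\alpha|}(-x)_\alpha$. For $|\alpha|\le N$ the monic Krawtchouk polynomial $\mathsf L_\alpha(\cdot;\rho,N)$ is the unique element of $\mathcal V_{|\alpha|}^d(\mathsf K_{\rho,N})$ with $\mathsf L_\alpha-\mathrm m_\alpha\in\Pi_{|\alpha|-1}^d$ (as functions on $\mathbb Z_N^{d+1}$). *)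

(* Defs.v *)
From HB Require Import structures.
From Stdlib Require Import ClassicalEpsilon.
From mathcomp Require Import all_boot all_order all_algebra.
From mathcomp Require Import mpoly.

Set Implicit Arguments.
Unset Strict Implicit.
Unset Printing Implicit Defensive.

Import Order.TTheory GRing.Theory Num.Theory.

Local Open Scope ring_scope.

(** Rising factorial [(a)_n = a (a + 1) ... (a + n - 1)]. *)
Definition poch (R : pzRingType) (a : R) (n : nat) : R :=
  \prod_(i < n) (a + i%:R).

Section MultiIndex.
Variables (R : comUnitRingType) (k : nat).
Implicit Types (y : 'I_k -> R) (a : 'X_{1..k}).

(** [(y)_a], [y ^ a] and [a!] for a multi-index [a]; [|a|] is [mdeg a]. *)
Definition mpoch y a : R := \prod_(i < k) poch (y i) (a i).
Definition mpow y a : R := \prod_(i < k) y i ^+ a i.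
Definition mfact a : nat := \prod_(i < k) (a i)`!.

Definition mnegr a : 'I_k -> R := fun i => - (a i)%:R.
End MultiIndex.

Arguments mnegr R {k} a.

(** [{a in N^(d+1) : |a| = N}], as a finite type. *)
Definition simplexZ (d N : nat) : Type :=
  {x : 'X_{1..d.+1 < N.+1} | mdeg x == N}.
HB.instance Definition _ d N := Finite.on (simplexZ d N).

Definition simplexZ_mnm d N (x : simplexZ d N) : 'X_{1..d.+1} := bmnm (sval x).
Coercion simplexZ_mnm : simplexZ >-> multinom.

(** [(rho, 1 - |rho|)]; the last coordinate has index [ord_max]. *)
Definition rho_ext (R : pzRingType) (d : nat) (rho : 'I_d -> R) : 'I_d.+1 -> R :=
  fun i => if unlift ord_max i is Some j then rho j else 1 - \sum_(j < d) rho j.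

Section Krawtchouk.
Variables (R : realFieldType) (d : nat) (rho : 'I_d -> R) (N : nat).
Implicit Types (f g h : {ffun simplexZ d N -> R}) (n : nat) (a : 'X_{1..d.+1}).

Definition kinner f g : R :=
  N`!%:R * \sum_(x : simplexZ d N)
    f x * g x * (mpow (rho_ext rho) x / (mfact x)%:R).

(** [polyZ n f]: [f] is the restriction to the simplex of a polynomial in the
    first [d] variables of total degree [< n], i.e. [f] belongs to
    [Pi_{n-1}^d].  As [msize p] is the degree plus one, and [0] for [p = 0],
    the case [n = 0] is [Pi_{-1}^d = {0}]. *)
Definition polyZ n f : Prop :=
  exists2 p : {mpoly R[d]}, (msize p <= n)%N &
    forall x : simplexZ d N,
      f x = p.@[fun i : 'I_d => (x (lift ord_max i))%:R].

(** [V_n^d(K_{rho,N})]. *)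
Definition orthZ n f : Prop :=
  polyZ n.+1 f /\ (forall g, polyZ n g -> kinner f g = 0).

Definition mmonic a : {ffun simplexZ d N -> R} :=
  [ffun x : simplexZ d N => (-1) ^+ mdeg a * mpoch (mnegr R x) a].

Definition is_krawtchouk a f : Prop :=
  orthZ (mdeg a) f /\ polyZ (mdeg a) (f - mmonic a).

(** The unique function satisfying [is_krawtchouk a]; see
    [krawtchouk_exists] and [krawtchouk_unique] below. *)
Definition krawtchouk a : {ffun simplexZ d N -> R} :=
  epsilon (inhabits 0) (is_krawtchouk a).

Lemma polyZ0 n : polyZ n 0.
Proof. by exists 0; [rewrite msize0 | move=> x; rewrite ffunE meval0]. Qed.

Lemma polyZD n f g : polyZ n f -> polyZ n g -> polyZ n (f + g).
Proof.
move=> [p sp fp] [q sq gq]; exists (p + q).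
  by rewrite (leq_trans (msizeD_le _ _)) // geq_max sp sq.
by move=> x; rewrite ffunE fp gq mevalD.
Qed.

Lemma polyZZ n c f : polyZ n f -> polyZ n [ffun x => c * f x].
Proof.
move=> [p sp fp]; exists (c *: p); first exact: leq_trans (msizeZ_le _ _) sp.
by move=> x; rewrite ffunE fp mevalZ.
Qed.

Lemma polyZN n f : polyZ n f -> polyZ n (- f).
Proof.
move=> /(polyZZ (-1)); congr (polyZ n).
by apply/ffunP => x; rewrite !ffunE mulN1r.
Qed.

Lemma polyZS n f : polyZ n f -> polyZ n.+1 f.
Proof. by case=> p sp fp; exists p => //; apply: leqW. Qed.

Lemma kinnerC f g : kinner f g = kinner g f.
Proof. by rewrite /kinner; congr (_ * _); apply: eq_bigr => x _; rewrite (mulrC (f x)). Qed.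

Lemma kinnerD f g h : kinner (f + g) h = kinner f h + kinner g h.
Proof.
rewrite /kinner -mulrDr -big_split; congr (_ * _).
by apply: eq_bigr => x _; rewrite ffunE !mulrDl.
Qed.

Lemma kinnerZ c f h : kinner [ffun x => c * f x] h = c * kinner f h.
Proof.
rewrite /kinner [RHS]mulrCA [in RHS]mulr_sumr; congr (_ * _).
by apply: eq_bigr => x _; rewrite ffunE !mulrA.
Qed.

Lemma kinnerN f h : kinner (- f) h = - kinner f h.
Proof.
rewrite -[RHS]mulN1r -kinnerZ; congr (kinner _ h).
by apply/ffunP => x; rewrite !ffunE mulN1r.
Qed.

Lemma kinner0 h : kinner 0 h = 0.
Proof.
by rewrite /kinner big1 ?mulr0 // => x _; rewrite ffunE !mul0r.
Qed.

Hypothesis rho01 : forall i, 0 < rho i < 1.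
Hypothesis rho_lt1 : \sum_(i < d) rho i < 1.

Lemma rho_ext_gt0 i : 0 < rho_ext rho i.
Proof.
rewrite /rho_ext; case: unliftP => [j _|_]; last by rewrite subr_gt0.
by case/andP: (rho01 j).
Qed.

Lemma kinner_eq0 f : kinner f f = 0 -> f = 0.
Proof.
have Np : N`!%:R != 0 :> R by rewrite pnatr_eq0 -lt0n fact_gt0.
have w_gt0 (x : simplexZ d N) : 0 < mpow (rho_ext rho) x / (mfact x)%:R.
  rewrite divr_gt0 //; first by apply: prodr_gt0 => i _; rewrite exprn_gt0 ?rho_ext_gt0.
  by rewrite ltr0n prodn_gt0 // => i; rewrite fact_gt0.
move=> /eqP; rewrite mulf_eq0 (negPf Np) /= psumr_eq0; last first.
  by move=> x _; apply: mulr_ge0; [rewrite -expr2 sqr_ge0 | apply: ltW].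
move=> /allP f0; apply/ffunP => x; rewrite ffunE.
have := f0 x (mem_index_enum _); rewrite /= !mulf_eq0 orbb.
by have := w_gt0 x; rewrite lt0r mulf_eq0 => /andP[/negPf-> _]; rewrite orbF => /eqP.
Qed.

Definition linearZ (S : {ffun simplexZ d N -> R} -> Prop) : Prop :=
  [/\ S 0, forall f g, S f -> S g -> S (f + g)
    & forall c f, S f -> S [ffun x => c * f x]].

Lemma linearZ_orth f : linearZ (fun g => kinner f g = 0).
Proof.
split=> [|g h fg fh|c g fg]; rewrite kinnerC ?kinner0 //.
  by rewrite kinnerD !(kinnerC _ f) fg fh addr0.
by rewrite kinnerZ kinnerC fg mulr0.
Qed.

Lemma orth_projection (s : seq {ffun simplexZ d N -> R}) f :
  exists2 g, forall S, linearZ S -> (forall h, h \in s -> S h) -> S g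
           & forall h, h \in s -> kinner (f - g) h = 0.
Proof.
elim: s f => [|b s IHs] f; first by exists 0 => // S [].
have [gb gb_span gb_orth] := IHs b; have [gf gf_span gf_orth] := IHs f.
pose e := b - gb; pose c := kinner (f - gf) e / kinner e e.
have eE : e = b + [ffun x => -1 * gb x].
  by apply/ffunP => x; rewrite !ffunE mulN1r.
exists (gf + [ffun x => c * e x]) => [S linS Ss|].
  have [S0 SD SZ] := linS.
  have Sin h : h \in s -> S h by move=> hs; apply: Ss; rewrite inE hs orbT.
  apply: (SD); first exact: gf_span.
  apply: (SZ); rewrite eE; apply: SD; first by apply: Ss; rewrite inE eqxx.
  by apply: (SZ); apply: gb_span.
set r := f - _; have rE h : kinner r h = kinner (f - gf) h - c * kinner e h.
  by rewrite /r opprD addrA (kinnerD (f - gf)) kinnerN kinnerZ.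
have r_orth h : h \in s -> kinner r h = 0.
  by move=> hs; rewrite rE gf_orth // gb_orth // mulr0 subr0.
have re : kinner r e = 0.
  rewrite rE /c; have [e0|e0] := eqVneq (kinner e e) 0; last first.
    by rewrite divfK // subrr.
  by rewrite (kinner_eq0 e0) kinnerC !kinner0 mulr0 subr0.
move=> h; rewrite inE => /orP[/eqP->|]; last exact: r_orth.
have [_ orthD _] := linearZ_orth r.
have -> : b = e + gb by rewrite /e subrK.
by apply: orthD => //; apply: (gb_span _ (linearZ_orth r)).
Qed.

Lemma mmonic_polyZ a : polyZ (mdeg a).+1 (mmonic a).
Proof.
have sizeM (p q : {mpoly R[d]}) m n :
    (msize p <= m.+1)%N -> (msize q <= n.+1)%N -> (msize (p * q) <= (m + n).+1)%N.
  move=> sp sq; have [->|p0] := eqVneq p 0; first by rewrite mul0r msize0.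
  have [->|q0] := eqVneq q 0; first by rewrite mulr0 msize0.
  rewrite msizeM //; move: sp sq; rewrite -!subn1 leq_subLR => sp sq.
  by rewrite (leq_trans (leq_add sp sq)) // addSn addnS.
pose X (i : 'I_d.+1) : {mpoly R[d]} :=
  if unlift ord_max i is Some j then 'X_j else N%:R%:MP - \sum_(j < d) 'X_j.
have sizeX i : (msize (X i) <= 2)%N.
  rewrite /X; case: unliftP => [j _|_]; first by rewrite msizeX mdeg1.
  rewrite (leq_trans (msizeD_le _ _)) // geq_max msizeN.
  rewrite msizeC (leq_trans (leq_b1 _)) //=.
  by apply: (leq_trans (msize_sum _ _ _)); apply/bigmax_leqP => j _; rewrite msizeX mdeg1.
have XE i (x : simplexZ d N) :
    (X i).@[fun j : 'I_d => (x (lift ord_max j))%:R] = (x i)%:R.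
  rewrite /X; case: unliftP => [j ->|->]; first by rewrite mevalXU.
  rewrite mevalB mevalC (big_morph _ (mevalD _) (meval0 _)).
  under eq_bigr do rewrite mevalXU.
  have xN : mdeg x = N by apply/eqP; case: (x).
  rewrite -{1}xN mdegE big_ord_recr /= natrD natr_sum.
  have wE (j : 'I_d) : widen_ord (leqnSn d) j = lift ord_max j.
    by apply: val_inj; rewrite /= /bump leqNgt ltn_ord.
  under eq_bigr do rewrite wE.
  by rewrite addrC addKr.
pose F i : {mpoly R[d]} := \prod_(j < a i) (X i - (j%:R)%:MP).
have sizeF i : (msize (F i) <= (a i).+1)%N.
  rewrite /F; elim: (a i) => [|n IHn]; first by rewrite big_ord0 msize1.
  rewrite big_ord_recr /= -addn1; apply: sizeM => //.
  rewrite (leq_trans (msizeD_le _ _)) // geq_max msizeN sizeX.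
  by rewrite msizeC (leq_trans (leq_b1 _)).
exists (\prod_i F i).
  rewrite mdegE.
  elim/big_ind2: _ => [|p n q m|i _]; by [rewrite msize1 | apply: sizeM | apply: sizeF].
move=> x; rewrite ffunE (big_morph _ (mevalM _) (meval1 _)) mdegE.
rewrite -prodrXr -big_split /=; apply: eq_bigr => i _.
rewrite (big_morph _ (mevalM _) (meval1 _)) /poch -[X in (-1) ^+ X]card_ord.
rewrite -prodr_const -big_split /=; apply: eq_bigr => j _.
by rewrite mevalB mevalC XE mulN1r opprD opprK.
Qed.

Lemma polyZ_span n : exists s : seq {ffun simplexZ d N -> R},
  (forall f, f \in s -> polyZ n f) /\
  (forall S, linearZ S -> (forall f, f \in s -> S f) -> forall f, polyZ n f -> S f).
Proof.
pose e (m : 'X_{1..d < n}) : {ffun simplexZ d N -> R} :=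
  [ffun x : simplexZ d N =>
    'X_[m].@[fun i : 'I_d => (x (lift ord_max i))%:R]].
exists [seq e m | m : 'X_{1..d < n}]; split.
  move=> f /mapP[m _ ->]; exists 'X_[m]; first by rewrite msizeX; case: m.
  by move=> x; rewrite ffunE.
move=> S [S0 SD SZ] Se f [p sp fp].
have -> : f = \sum_(m : 'X_{1..d < n}) [ffun x => p@_m * e m x].
  apply/ffunP => x; rewrite sum_ffunE fp [p in LHS](mpolywE sp).
  rewrite (big_morph _ (mevalD _) (meval0 _)); apply: eq_bigr => m _.
  by rewrite !ffunE mevalZ.
elim/big_ind: _ => // m _; apply: SZ; apply: Se.
by apply/mapP; exists m; rewrite ?mem_enum.
Qed.

Lemma krawtchouk_exists a : exists f, is_krawtchouk a f.
Proof.
have [s [s_poly s_span]] := polyZ_span (mdeg a).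
have [g g_span g_orth] := orth_projection s (mmonic a).
have g_poly : polyZ (mdeg a) g.
  apply: g_span => //; split; [exact: polyZ0 | exact: polyZD | exact: polyZZ].
exists (mmonic a - g); split; first split.
- by apply: polyZD; [exact: mmonic_polyZ | apply/polyZN/polyZS].
- exact: (s_span _ (linearZ_orth _)).
- by rewrite addrAC subrr add0r; apply: polyZN.
Qed.

Lemma krawtchouk_unique a f g :
  is_krawtchouk a f -> is_krawtchouk a g -> f = g.
Proof.
move=> [[_ f_orth] f_lead] [[_ g_orth] g_lead].
have fg_poly : polyZ (mdeg a) (f - g).
  have -> : f - g = (f - mmonic a) - (g - mmonic a) by rewrite opprB addrA subrK.
  by apply: polyZD => //; apply: polyZN.
apply/eqP; rewrite -subr_eq0; apply/eqP/kinner_eq0.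
by rewrite [LHS]kinnerD kinnerN f_orth // g_orth // subr0.
Qed.

Lemma krawtchoukP a : is_krawtchouk a (krawtchouk a).
Proof. exact: epsilon_spec (krawtchouk_exists a). Qed.
End Krawtchouk.

(* Main.v *)
(** Give a function [f] on the simplex the generating function
    [sum_x N!/x! rho^x f(x) t^x].  Differentiating the multinomial theorem, that
    of [m_g] is [N (N - 1) ... (N - |g| + 1) rho^g t^g r^(N - |g|)] with
    [r = sum_i rho_i t_i].  Hence that of the right-hand side of the first
    formula is a constant times [r^(N - |a|) prod_i (r - t_i)^(a_i)].  At
    [t_i = 1 + X_i], since the weights sum to [1], every [r - t_i] is a linear
    form in [X], so no monomial [X^b] with [|b| < |a|] occurs.  This is
    orthogonality to the products of binomials [C(x_i, b_i)] with [|b| < |a|],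
    and these span the polynomials of degree [< |a|].  The second formula is the
    binomial inversion of the first. *)

Require Import Defs.
From HB Require Import structures.
From mathcomp Require Import all_boot all_order all_algebra.
From mathcomp Require Import mpoly ring.

Set Implicit Arguments.
Unset Strict Implicit.
Unset Printing Implicit Defensive.

Import Order.TTheory GRing.Theory Num.Theory.

Local Open Scope ring_scope.

(** * Multi-indices: order, degree and induction *)

Lemma mnm_le_mdeg k (b c : 'X_{1..k}) : (b <= c)%MM -> (mdeg b <= mdeg c)%N.
Proof. by move=> bc; rewrite -(submK bc) mdegD leq_addl. Qed.

Lemma mnm_le_mdeg_eq k (b c : 'X_{1..k}) : (b <= c)%MM -> mdeg b = mdeg c -> b = c.
Proof.
move=> bc bc_deg; rewrite -[RHS](submK bc).
suff /eqP -> : (c - b)%MM == 0%MM by rewrite add0m.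
by rewrite -mdeg_eq0 -(eqn_add2r (mdeg b)) -mdegD submK // bc_deg.
Qed.

Lemma mdegB_le k (a b : 'X_{1..k}) :
  (b <= a)%MM -> (\sum_(i < k) (a i - b i))%N = (mdeg a - mdeg b)%N.
Proof.
move=> ba; rewrite -{2}(submK ba) mdegD addnK mdegE.
by apply: eq_bigr => i _; rewrite mnmBE.
Qed.

Lemma mnm_ind k (P : 'X_{1..k} -> Prop) :
  P 0%MM -> (forall i m, P m -> P (U_(i) + m)%MM) -> forall m, P m.
Proof.
move=> P0 PS m; move: {2}(mdeg m) (erefl (mdeg m)) => n.
elim: n m => [|n IHn] m mn.
  by have /eqP -> : m == 0%MM by rewrite -mdeg_eq0 mn.
have [i mi] : exists i, (U_(i) <= m)%MM.
  have: m != 0%MM by rewrite -mdeg_eq0 mn.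
  rewrite -mdeg_eq0 mdegE sum_nat_eq0 negb_forall => /existsP[i /= mi].
  by exists i; rewrite lep1mP.
rewrite -(submK mi) addmC; apply/PS/IHn.
by apply/eqP; rewrite -(eqn_add2l 1) -{1}(mdeg1 i) -mdegD addmC submK // mn.
Qed.

(** * The binomial theorem for multi-indices *)

Definition mbin k (a g : 'X_{1..k}) : nat := \prod_(i < k) 'C(a i, g i).

(** Letting every exponent range up to the common bound |a| turns the product of sums into a sum
    over functions into one finite type. Functions not below [a] bring in a vanishing binomial; the
    others are the multi-indices below [a]. *)
Lemma multibinomial (S : comPzRingType) k (y z : 'I_k -> S) (a : 'X_{1..k}) :
  \prod_(i < k) (y i + z i) ^+ a i =
  \sum_(g : 'X_{1..k < (mdeg a).+1} | (g <= a)%MM)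
    (mbin a g)%:R * (\prod_(i < k) y i ^+ g i) * \prod_(i < k) z i ^+ (a i - g i).
Proof.
set K := mdeg a.
have aK i : (a i <= K)%N by rewrite /K mdegE (bigD1 i) //= leq_addr.
have binE i : (y i + z i) ^+ a i =
    \sum_(j < K.+1) 'C(a i, j)%:R * y i ^+ j * z i ^+ (a i - j).
  rewrite addrC exprDn (big_ord_widen K.+1 (fun j =>
    z i ^+ (a i - j) * y i ^+ j *+ 'C(a i, j))) ?ltnS // big_mkcond /=.
  apply: eq_bigr => j _; rewrite ltnS; case: leqP => [_|aj].
    by rewrite -mulr_natl mulrA mulrAC.
  by rewrite bin_small // !mul0r.
rewrite (eq_bigr _ (fun i _ => binE i)) bigA_distr_bigA /=.
(* The default [bm0] is taken only for [f] of degree above [K]; the reindexing condition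
   [h' (h f) == f] rejects such [f]. *)
pose h (f : {ffun 'I_k -> 'I_K.+1}) : 'X_{1..k < K.+1} :=
  insubd (@bm0 k K) [multinom f i : nat | i < k].
pose h' (g : 'X_{1..k < K.+1}) : {ffun 'I_k -> 'I_K.+1} := [ffun i => inord (g i)].
have h'K (g : 'X_{1..k < K.+1}) : (g <= a)%MM -> h (h' g) = g.
  move=> ga; apply: val_inj; rewrite /h val_insubd /=.
  have -> : [multinom h' g i : nat | i < k] = g.
    apply/mnmP => i; rewrite mnmE ffunE inordK // ltnS.
    by apply: leq_trans (aK i); apply: (mnm_lepP ga).
  by rewrite bmdeg.
rewrite (reindex_onto h h') //= [LHS](bigID
  (fun f : {ffun 'I_k -> 'I_K.+1} => [forall i, f i <= a i]%N)) /=.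
rewrite [X in _ + X]big1 ?addr0 => [|f]; last first.
  rewrite negb_forall => /existsP[i]; rewrite -ltnNge => ai.
  by rewrite (bigD1 i) //= bin_small // !mul0r.
have hE (f : {ffun 'I_k -> 'I_K.+1}) : [forall i, f i <= a i]%N ->
    bmnm (h f) = [multinom f i : nat | i < k].
  move=> /forallP fa; rewrite /h -[bmnm _]/(val _) val_insubd.
  suff -> : (mdeg [multinom f i : nat | i < k] < K.+1)%N by [].
  rewrite ltnS; apply: (@leq_trans (\sum_i a i)); last by rewrite -mdegE.
  by rewrite mdegE; apply: leq_sum => i _; rewrite mnmE.
apply: eq_big => [f|f fa]; last first.
  rewrite hE // /mbin natr_prod -!big_split /=; apply: eq_bigr => i _.
  by rewrite mnmE.
apply/idP/idP => [fa|/andP[ha /eqP h'h]].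
  rewrite hE //; apply/andP; split.
    by apply/mnm_lepP => i; rewrite mnmE; apply: (forallP fa).
  by apply/eqP/ffunP => i; rewrite ffunE hE // mnmE inord_val.
apply/forallP => i; rewrite -h'h ffunE inordK ?(mnm_lepP ha) //.
by rewrite ltnS; apply: leq_trans (mnm_lepP ha i) (aK i).
Qed.

(** * The multinomial theorem through iterated derivatives *)

Section Multinomial.
Variables (R : numFieldType) (k : nat).

Lemma mderiv_exp (p : {mpoly R[k]}) i n :
  (p ^+ n)^`M(i) = n%:R * p ^+ n.-1 * p^`M(i).
Proof.
elim: n => [|n IHn]; first by rewrite expr0 -mpolyC1 mderivC !mul0r.
rewrite exprS mderivM IHn; case: n {IHn} => [|n] /=.
  by rewrite expr0; ring.
by rewrite exprS; ring.
Qed.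

Local Notation sumX := (\sum_(i < k) 'X_i : {mpoly R[k]}).

(** All first derivatives of the sum of the variables are 1, so only the order |m| counts and the
    power behaves as in one variable. *)
Lemma mderivm_sumX_exp n m :
  (sumX ^+ n)^`M[m] = (n ^_ (mdeg m))%:R * sumX ^+ (n - mdeg m).
Proof.
elim/mnm_ind: m n => [|i m IHm] n.
  by rewrite mderivm0m mdeg0 ffactn0 subn0 mul1r.
have sD : sumX^`M(i) = 1.
  rewrite raddf_sum (bigD1 i) //= mderivX mnm1E eqxx scale1r.
  rewrite -{1}[U_(i)%MM]add0m addmK mpolyX0.
  rewrite big1 ?addr0 // => j /negPf ji.
  by rewrite mderivX mnm1E ji scale0r.
rewrite mderivmDm mderivmU1m mderiv_exp sD mulr1 mulr_natl mderivmMn IHm.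
by rewrite mdegD mdeg1 add1n ffactnS natrM -mulrA !mulr_natl -subn1 -subnDA.
Qed.

Lemma mfact_neq0 (m : 'X_{1..k}) : (mfact m)%:R != 0 :> R.
Proof. by rewrite pnatr_eq0 -lt0n prodn_gt0 // => i; rewrite fact_gt0. Qed.

(** The coefficient at [m] times m! is the constant term of the [m]-th derivative, which is nonzero
    only for |m| = n. *)
Lemma mcoeff_sumX_exp n m :
  (sumX ^+ n)@_m = if mdeg m == n then n`!%:R / (mfact m)%:R else 0.
Proof.
apply: (mulIf (mfact_neq0 m)).
have -> : (sumX ^+ n)@_m * (mfact m)%:R = ((sumX ^+ n)^`M[m])@_0.
  rewrite mcoeff_mderivm addm0 mulr_natr /mfact; congr (_ *+ _).
  by apply: eq_bigr => i _; rewrite ffactnn.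
rewrite mderivm_sumX_exp mulr_natl mcoeffMn.
have s0 : sumX@_0 = 0.
  rewrite raddf_sum big1 //= => i _; rewrite mcoeffX.
  by rewrite -mdeg_eq0 mdeg1.
case: (ltngtP (mdeg m) n) => mn; last 1 first.
- by rewrite mn subnn expr0 mcoeff1 eqxx ffactnn divfK ?mfact_neq0.
- by rewrite -[(n - _)%N](@prednK) ?subn_gt0 // exprS rmorphM /= s0 !mul0r mul0rn ?mul0r.
- by rewrite ffact_small // mulr0n mul0r.
Qed.

End Multinomial.

Lemma mdeg_simplexZ d N (x : simplexZ d N) : mdeg x = N.
Proof. by apply/eqP; case: x. Qed.

Lemma sumX_exp_simplexZ (R : numFieldType) d N :
  (\sum_(i < d.+1) 'X_i) ^+ N =
  \sum_(x : simplexZ d N) (N`!%:R / (mfact x)%:R) *: 'X_[x] :> {mpoly R[d.+1]}.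
Proof.
apply/mpolyP => m; rewrite mcoeff_sumX_exp raddf_sum /=.
case: eqVneq => [mN|mN]; last first.
  rewrite big1 // => x _; rewrite mcoeffZ mcoeffX.
  case: eqVneq => [xm|]; rewrite ?mulr0 //.
  by rewrite -xm mdeg_simplexZ eqxx in mN.
have mb : (mdeg m < N.+1)%N by rewrite mN.
have mZ : mdeg (BMultinom mb) == N by apply/eqP.
pose y : simplexZ d N := exist _ (BMultinom mb) mZ.
rewrite (bigD1 y) //= mcoeffZ mcoeffX eqxx mulr1.
rewrite big1 ?addr0 // => x /eqP xy; rewrite mcoeffZ mcoeffX.
case: (simplexZ_mnm x =P m) => [xm|]; rewrite ?mulr0 //.
by case: xy; do 2!apply: val_inj.
Qed.

(** * Generating functions of falling factorials *)

Definition mffact k (x g : 'X_{1..k}) : nat := \prod_(i < k) (x i) ^_ (g i).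

(** Differentiating [g] times and multiplying by X^g scales the coefficient of X^x by a falling
    factorial of x. This is applied to the multinomial theorem, followed by the substitution of w_i
    t_i for X_i. The t_i are polynomials so that 1 + X_i can be inserted later. *)
Lemma sum_simplexZ_mffact (R : numFieldType) d N (w : 'I_d.+1 -> R)
    (t : 'I_d.+1 -> {mpoly R[d.+1]}) (g : 'X_{1..d.+1}) :
  \sum_(x : simplexZ d N) (N`!%:R / (mfact x)%:R * mpow w x * (mffact x g)%:R)
    *: \prod_i t i ^+ x i =
  (N ^_ mdeg g)%:R * mpow w g *: \prod_i t i ^+ g i
    * (\sum_i w i *: t i) ^+ (N - mdeg g).
Proof.
have /(congr1 (fun p => 'X_[g] * p^`M[g])) := sumX_exp_simplexZ R d N.
rewrite mderivm_sumX_exp raddf_sum /= mulr_sumr.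
pose u := [tuple w i *: t i | i < d.+1].
have uX (m : 'X_{1..d.+1}) : 'X_[m] \mPo u = mpow w m *: \prod_i t i ^+ m i.
  rewrite comp_mpolyX /mpow -scaler_prod; apply: eq_bigr => i _.
  by rewrite tnth_mktuple exprZn.
have XE (x : simplexZ d N) :
    'X_[g] * ((N`!%:R / (mfact x)%:R) *: 'X_[x])^`M[g] =
    (N`!%:R / (mfact x)%:R * (mffact x g)%:R) *: 'X_[x] :> {mpoly R[d.+1]}.
  rewrite mderivmZ mderivmX scalerA -scalerAr -mpolyXD.
  (* For [g] not below [x] the exponent x - g is truncated, but the factor left by the derivative is
     0, as is [mffact x g]. *)
  have [gx|] := boolP (g <= x)%MM; first by rewrite addmC submK.
  rewrite negb_forall => /existsP[i]; rewrite -ltnNge => xg.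
  by rewrite /mffact (bigD1 i) //= ffact_small // mul0n mulr0 !scale0r.
rewrite (eq_bigr _ (fun x _ => XE x)) => /(congr1 (fun p => p \mPo u)).
rewrite !rmorphM !rmorphXn raddf_sum rmorph_nat /= uX => E.
have <- : \sum_(i < d.+1) ('X_i \mPo u) = \sum_(i < d.+1) w i *: t i.
  by apply: eq_bigr => i _; rewrite comp_mpolyXU -tnth_nth tnth_mktuple.
rewrite -scalerA -scalerAl scaler_nat -[in RHS]mulr_natl mulrCA E raddf_sum /=.
apply: eq_bigr => x _; rewrite comp_mpolyZ uX scalerA; congr (_ *: _).
by rewrite mulrAC.
Qed.

Lemma poch_opp_nat (R : comPzRingType) n k :
  poch (- n%:R : R) k = (-1) ^+ k * (n ^_ k)%:R.
Proof.
elim: k => [|k IHk]; first by rewrite /poch big_ord0 mul1r.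
rewrite /poch big_ord_recr -/(poch _ _) IHk /= ffactnSr exprSr natrM.
(* Once [k] exceeds [n] the falling factorial is already 0, so the truncated n - k does no harm. *)
have [kn|nk] := leqP k n; last by rewrite ffact_small // mul0r !mulr0 mul0r.
by rewrite natrB //; ring.
Qed.

Lemma mpoch_opp_mnm (R : comUnitRingType) k (x g : 'X_{1..k}) :
  mpoch (mnegr R x) g = (-1) ^+ mdeg g * (mffact x g)%:R.
Proof.
rewrite mdegE -prodrXr /mffact natr_prod -big_split /=.
by apply: eq_bigr => i _; rewrite poch_opp_nat.
Qed.

Lemma mffact_mbin k (x g : 'X_{1..k}) : mffact x g = (mbin x g * mfact g)%N.
Proof. by rewrite /mffact -big_split /=; apply: eq_bigr => i _; rewrite bin_ffact. Qed.

Lemma mmonicE (R : realFieldType) d N g (x : simplexZ d N) :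
  mmonic R N g x = (mffact x g)%:R.
Proof. by rewrite ffunE mpoch_opp_mnm mulrA -exprMn mulrNN mulr1 expr1n mul1r. Qed.

(** * Binomial inversion *)

Lemma mbin_inversion (R : comNzRingType) k (u v : 'X_{1..k} -> R) a :
  (forall b, (b <= a)%MM ->
     v b = \sum_(g : 'X_{1..k < (mdeg b).+1} | (g <= b)%MM) (mbin b g)%:R * u g) ->
  u a = \sum_(b : 'X_{1..k < (mdeg a).+1} | (b <= a)%MM)
          (-1) ^+ (mdeg a - mdeg b) * (mbin a b)%:R * v b.
Proof.
move=> vE.
(* The linear functional [X^g |-> u g] maps [(X + 1)^b] to [v b]; apply it to
   [X^a = ((X + 1) - 1)^a]. *)
pose L (p : {mpoly R[k]}) := \sum_(m : 'X_{1..k < (mdeg a).+1}) p@_m * u m.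
have LX m : (mdeg m <= mdeg a)%N -> L 'X_[m] = u m.
  move=> ma; have mb : (mdeg m < (mdeg a).+1)%N by [].
  rewrite /L (bigD1 (BMultinom mb)) //= mcoeffX eqxx mul1r big1 ?addr0 // => c cm.
  rewrite mcoeffX; case: (m =P c) => [mc|]; rewrite ?mul0r //.
  by case/eqP: cm; apply: val_inj.
have L0 : L 0 = 0 by rewrite /L big1 // => m _; rewrite mcoeff0 mul0r.
have LD p q : L (p + q) = L p + L q.
  by rewrite /L -big_split; apply: eq_bigr => m _; rewrite mcoeffD mulrDl.
have LZ c p : L (c *: p) = c * L p.
  by rewrite /L mulr_sumr; apply: eq_bigr => m _; rewrite mcoeffZ mulrA.
have LX1 b : (b <= a)%MM -> L (\prod_i ('X_i + 1) ^+ b i) = v b.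
  move=> ba; rewrite vE // multibinomial (big_morph L LD L0); apply: eq_bigr => g gb.
  rewrite [X in L (_ * X)]big1 ?mulr1 => [|i _]; last by rewrite expr1n.
  rewrite -mpolyXE_id mulr_natl -scaler_nat LZ LX //.
  by rewrite (leq_trans (mnm_le_mdeg gb)) ?mnm_le_mdeg.
have -> : u a = L (\prod_i (('X_i + 1) + (-1)) ^+ a i).
  under eq_bigr do rewrite addrK.
  by rewrite -mpolyXE_id LX.
rewrite multibinomial (big_morph L LD L0); apply: eq_bigr => b ba.
rewrite prodrXr mdegB_le // -(LX1 _ ba) -LZ; congr L.
rewrite -mul_mpolyC rmorphM rmorphXn rmorphN1 rmorph_nat.
by ring.
Qed.

(** At t_i = 1 + X_i, the coefficients of a generating function thus become the pairings of the
    function with products of binomials. *)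
Lemma mcoeff_prod1X (R : comNzRingType) k (b m : 'X_{1..k}) :
  (\prod_i (1 + 'X_i) ^+ m i : {mpoly R[k]})@_b = (mbin m b)%:R.
Proof.
rewrite (eq_bigr (fun i => ('X_i + 1) ^+ m i)) => [|i _]; last by rewrite addrC.
rewrite multibinomial raddf_sum /=.
have gE (g : 'X_{1..k < (mdeg m).+1}) : ((mbin m g)%:R * \prod_(i < k) 'X_i ^+ g i
     * \prod_(i < k) 1 ^+ (m i - g i) : {mpoly R[k]})@_b = (mbin m g)%:R * (bmnm g == b)%:R.
  rewrite -mpolyXE_id [X in _ * X]big1 ?mulr1 => [|i _]; last by rewrite expr1n.
  by rewrite mulr_natl mcoeffMn mcoeffX mulr_natl.
under eq_bigr do rewrite gE.
have [bm|] := boolP (b <= m)%MM.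
  have bb : (mdeg b < (mdeg m).+1)%N by apply: mnm_le_mdeg.
  rewrite (bigD1 (BMultinom bb)) //= eqxx mulr1 big1 ?addr0 // => g /andP[_ gb].
  case: (bmnm g =P b) => [gE'|]; rewrite ?mulr0 //.
  by case/eqP: gb; apply: val_inj.
move=> bm; have -> : mbin m b = 0%N.
  move: bm; rewrite negb_forall => /existsP[i]; rewrite -ltnNge => mb.
  by rewrite /mbin (bigD1 i) //= bin_small.
rewrite big1 // => g gm; case: (bmnm g =P b) => [gE'|]; rewrite ?mulr0 //.
by rewrite -gE' gm in bm.
Qed.

(** * The right-hand side of the first formula and its orthogonality *)

Section Expansion.
Variables (R : realFieldType) (d N : nat) (w : 'I_d.+1 -> R).
Implicit Types a g : 'X_{1..d.+1}.

(** Since (-a)_g (-1)^|g| / g! is the binomial [mbin a g], division by [knorm] makes the first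
    formula a plain binomial transform. *)
Definition knorm a : R := poch (- N%:R) (mdeg a) * mpow w a.

Definition kraw a : {ffun simplexZ d N -> R} :=
  [ffun x => knorm a * \sum_(g : 'X_{1..d.+1 < (mdeg a).+1} | (g <= a)%MM)
    (mbin a g)%:R / knorm g * mmonic R N g x].

Hypothesis w_neq0 : forall i, w i != 0.

Lemma mpow_neq0 a : mpow w a != 0.
Proof. by apply/prodf_neq0 => i _; rewrite expf_neq0. Qed.

Lemma knorm_neq0 a : (mdeg a <= N)%N -> knorm a != 0.
Proof.
move=> aN; rewrite mulf_neq0 ?mpow_neq0 // poch_opp_nat mulf_neq0 ?signr_eq0 //.
by rewrite pnatr_eq0 -lt0n ffact_gt0.
Qed.

(** In the term of [g], division by [knorm g] cancels the falling factorial of N and w^g up to the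
    sign (-1)^|g|. Splitting r^(N - |g|) into r^(|a| - |g|) and r^(N - |a|) leaves the binomial
    expansion of the product of the (r - t_i)^(a_i). *)
Lemma kraw_generating a (t : 'I_d.+1 -> {mpoly R[d.+1]}) : (mdeg a <= N)%N ->
  \sum_(x : simplexZ d N) (N`!%:R / (mfact x)%:R * mpow w x * kraw a x)
    *: \prod_i t i ^+ x i =
  knorm a *: \prod_i ((\sum_j w j *: t j) - t i) ^+ a i
    * (\sum_i w i *: t i) ^+ (N - mdeg a).
Proof.
move=> aN; set r := \sum_i w i *: t i.
transitivity (\sum_(g : 'X_{1..d.+1 < (mdeg a).+1} | (g <= a)%MM)
    (knorm a * (mbin a g)%:R / knorm g) *: \sum_(x : simplexZ d N)
      (N`!%:R / (mfact x)%:R * mpow w x * (mffact x g)%:R) *: \prod_i t i ^+ x i).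
  under [RHS]eq_bigr do rewrite scaler_sumr.
  rewrite exchange_big /=; apply: eq_bigr => x _.
  rewrite /kraw ffunE !mulr_sumr scaler_suml; apply: eq_bigr => g _.
  by rewrite mmonicE scalerA; congr (_ *: _); ring.
have prodE : \prod_i (r - t i) ^+ a i = \sum_(g : 'X_{1..d.+1 < (mdeg a).+1} | (g <= a)%MM)
    ((-1) ^+ mdeg g * (mbin a g)%:R) *: (\prod_i t i ^+ g i * r ^+ (mdeg a - mdeg g)).
  under eq_bigr do rewrite addrC -mulN1r.
  rewrite multibinomial; apply: eq_bigr => g ga.
  have -> : \prod_i (-1 * t i) ^+ g i = (-1) ^+ mdeg g * \prod_i t i ^+ g i.
    by rewrite (mdegE g) -prodrXr -big_split; apply: eq_bigr => i _; rewrite exprMn.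
  rewrite prodrXr mdegB_le // -mul_mpolyC.
  by rewrite rmorphM rmorphXn rmorphN1 rmorph_nat; ring.
rewrite prodE scaler_sumr mulr_suml; apply: eq_bigr => g ga.
have ga_deg := mnm_le_mdeg ga.
rewrite sum_simplexZ_mffact scalerA.
have -> : (N - mdeg g = (mdeg a - mdeg g) + (N - mdeg a))%N.
  by rewrite addnC addnBA // subnK.
rewrite exprD mulrA -!scalerAl !scalerA; congr (_ *: _).
have := knorm_neq0 (leq_trans ga_deg aN); rewrite /knorm poch_opp_nat.
rewrite !mulf_eq0 !negb_or => /andP[/andP[_ Ng] wg].
rewrite !invfM invr_sign.
by field; rewrite Ng wg.
Qed.

Hypothesis sum_w : \sum_i w i = 1.

Lemma kraw_orth_mbin a b : (mdeg b < mdeg a)%N -> (mdeg a <= N)%N ->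
  \sum_(x : simplexZ d N)
    N`!%:R / (mfact x)%:R * mpow w x * kraw a x * (mbin x b)%:R = 0.
Proof.
move=> ba aN.
have /(congr1 (mcoeff b)) := kraw_generating (fun i => 1 + 'X_i) aN.
rewrite raddf_sum /= => E.
under eq_bigr do rewrite -mcoeff_prod1X -mcoeffZ.
rewrite {}E; set r := \sum_i w i *: _.
have rE : r = 1 + \sum_i w i *: 'X_i.
  rewrite /r; under eq_bigr do rewrite scalerDr.
  by rewrite big_split /= -scaler_suml sum_w scale1r.
set h := \prod_i _; have h_homog : h \is (mdeg a).-homog for mdeg.
  have : h \is (\sum_(i < d.+1) 1 * a i)%N.-homog for mdeg.
    rewrite /h; elim/big_ind2: _ => [|p n q m|i _]; [exact: dhomog1 | exact: dhomogM |].
    apply: dhomogMn; rewrite rE opprD addrACA subrr add0r.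
    apply: rpredB; last by rewrite dhomogX /= mdeg1.
    apply: rpred_sum => j _.
    by rewrite rpredZ ?dhomogX /= ?mdeg1.
  by under eq_bigr do rewrite mul1n; rewrite -mdegE.
(* In every splitting of [b] the exponent taken from [h] is below [b], so its degree is less than
   |a|, where the homogeneous [h] has no coefficient. *)
rewrite -scalerAl mcoeffZ mcoeffM big1 ?mulr0 // => k /eqP bk.
rewrite (dhomog_nemf_coeff h_homog) ?mul0r //.
have kb : (bmnm k.1 <= b)%MM by have := lem_addr k.1 k.2; rewrite -bk.
by rewrite neq_ltn (leq_ltn_trans _ ba) // mnm_le_mdeg.
Qed.
End Expansion.

(** * Products of binomials span the polynomials *)

Lemma mbinDU k (x b : 'X_{1..k}) i :
  (x i * mbin x b = (b i).+1 * mbin x (b + U_(i)) + b i * mbin x b)%N.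
Proof.
rewrite /mbin (bigD1 i) //= [X in (_ = _ * X + _)%N](bigD1 i) //=.
rewrite mnmDE mnm1E eqxx addn1.
rewrite [X in (_ = _ * (_ * X) + _)%N](eq_bigr (fun j => 'C(x j, b j))) => [|j /negPf ji]; last first.
  by rewrite mnmDE mnm1E eq_sym ji addn0.
rewrite !mulnA -mulnDl mul_bin_left -mulnDl; congr (_ * _)%N.
(* The subtraction x_i - b_i truncates when b_i > x_i, but then the binomial vanishes. *)
have [bx|xb] := leqP (b i) (x i); first by rewrite subnK.
by rewrite bin_small // !muln0.
Qed.

Section Span.
Variables (R : realFieldType) (d N : nat).

(** By [mbinDU], multiplying a binomial product by a coordinate raises its degree by at most one. A
    monomial is absorbed this way one variable at a time, so the induction runs over a monomial
    times a binomial product of total degree below [n]. *)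
Lemma polyZ_mbin_span (S : {ffun simplexZ d N -> R} -> Prop) n :
  Defs.linearZ S ->
  (forall b : 'X_{1..d.+1}, (mdeg b < n)%N ->
    S [ffun x : simplexZ d N => (mbin x b)%:R]) ->
  forall f, polyZ n f -> S f.
Proof.
move=> [S0 SD SZ] Sb f [p sp fp].
have Sm (m : 'X_{1..d}) (b : 'X_{1..d.+1}) : (mdeg m + mdeg b < n)%N ->
    S [ffun x : simplexZ d N => (mbin x b)%:R * \prod_(i < d) (x (lift ord_max i))%:R ^+ m i].
  elim/mnm_ind: m b => [|i m IHm] b mb.
    have := Sb b; rewrite -[mdeg b]add0n -{1}(@mdeg0 d) => /(_ mb).
    congr S; apply/ffunP => x; rewrite !ffunE big1 ?mulr1 // => i _.
    by rewrite mnm0E.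
  set j := lift ord_max i.
  have mb1 : (mdeg m + mdeg (b + U_(j)) < n)%N.
    by move: mb; rewrite !mdegD !mdeg1 addn1 add1n addnS addSn.
  have mb0 : (mdeg m + mdeg b < n)%N.
    by apply: leq_ltn_trans mb; rewrite leq_add2r mdegD leq_addl.
  have := SD _ _ (SZ (b j).+1%:R _ (IHm _ mb1)) (SZ (b j)%:R _ (IHm _ mb0)).
  congr S; apply/ffunP => x; rewrite !ffunE !mulrA -mulrDl -!natrM -natrD -mbinDU.
  pose y l : R := ((x : simplexZ d N) (lift ord_max l))%:R.
  rewrite [in RHS](eq_bigr (fun l => y l ^+ (U_(i)%MM l) * y l ^+ m l)).
    rewrite big_split /= [RHS]mulrA; congr (_ * _); rewrite natrM mulrC; congr (_ * _).
    rewrite (bigD1 i) //= mnm1E eqxx big1 ?mulr1 // => l /negPf li.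
    by rewrite mnm1E eq_sym li.
  by move=> l _; rewrite mnmDE exprD.
have -> : f = \sum_(m : 'X_{1..d < n}) [ffun x : simplexZ d N => p@_m *
    [ffun x : simplexZ d N => (mbin x 0%MM)%:R * \prod_(i < d) (x (lift ord_max i))%:R ^+ m i] x].
  apply/ffunP => x; rewrite sum_ffunE fp [p in LHS](mpolywE sp).
  rewrite (big_morph _ (mevalD _) (meval0 _)); apply: eq_bigr => m _.
  rewrite !ffunE mevalZ mevalX /mbin [X in X%:R]big1 ?mul1r // => i _.
  by rewrite mnm0E bin0.
by elim/big_ind: _ => // m _; apply/SZ/Sm; rewrite mdeg0 addn0 bmdeg.
Qed.

Lemma polyZ_le m n (f : {ffun simplexZ d N -> R}) : (m <= n)%N -> polyZ m f -> polyZ n f.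
Proof. by move=> mn [p pm fp]; exists p => //; apply: leq_trans mn. Qed.

End Span.

(** * Identification with the Krawtchouk polynomials, and the two formulas *)

Lemma kraw_is_krawtchouk (R : realFieldType) (d N : nat) (rho : 'I_d -> R)
    (rho01 : forall i : 'I_d, 0 < rho i < 1)
    (rho_lt1 : \sum_(i < d) rho i < 1) (a : 'X_{1..d.+1}) :
  (mdeg a <= N)%N -> is_krawtchouk rho a (kraw N (rho_ext rho) a).
Proof.
move=> aN; set w := rho_ext rho.
have w_neq0 i : w i != 0 by rewrite gt_eqF // rho_ext_gt0.
have sum_w : \sum_i w i = 1.
  rewrite big_ord_recr /= {2}/w /rho_ext unlift_none.
  have widenE (i : 'I_d) : w (widen_ord (leqnSn d) i) = rho i.
    have -> : widen_ord (leqnSn d) i = lift ord_max i.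
      by apply: val_inj; rewrite /= /bump leqNgt ltn_ord.
    by rewrite /w /rho_ext liftK.
  by rewrite (eq_bigr _ (fun i _ => widenE i)) addrC subrK.
(* The term g = a is exactly [mmonic a]; any other g below [a] has strictly smaller degree. *)
have lead : polyZ (mdeg a) (kraw N w a - mmonic R N a).
  have aa : (mdeg a < (mdeg a).+1)%N by [].
  have -> : kraw N w a - mmonic R N a =
      \sum_(g : 'X_{1..d.+1 < (mdeg a).+1} | (g <= a)%MM && (g != BMultinom aa))
      [ffun x : simplexZ d N => (knorm N w a * ((mbin a g)%:R / knorm N w g)) * mmonic R N g x].
    apply/ffunP => x; rewrite sum_ffunE /kraw !ffunE (bigD1 (BMultinom aa)) ?lepm_refl //=.
    have -> : mbin a a = 1%N by rewrite /mbin big1 // => i _; rewrite binn.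
    rewrite mulrDr mul1r mulrA mulfV ?knorm_neq0 // mul1r [X in X + _ - _]ffunE addrAC subrr add0r.
    by rewrite mulr_sumr; apply: eq_bigr => g _; rewrite [RHS]ffunE -!mulrA.
  apply: big_ind => [|f g pf pg|g /andP[ga g_neq]]; [exact: polyZ0 | exact: polyZD |].
  apply: polyZZ; apply: (polyZ_le (m := (mdeg g).+1)) (mmonic_polyZ _ _ _).
  rewrite ltn_neqAle mnm_le_mdeg // andbT; apply: contra g_neq => /eqP ga_deg.
  exact/eqP/val_inj/mnm_le_mdeg_eq.
split=> //; split.
  rewrite -[kraw _ _ _](subrK (mmonic R N a)); apply: polyZD (mmonic_polyZ _ _ _).
  exact: polyZS.
(* Orthogonality is linear in the test function, so products of binomials suffice. *)
apply: (polyZ_mbin_span (linearZ_orth rho _)) => b ba.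
rewrite /kinner mulr_sumr -[RHS](kraw_orth_mbin w_neq0 sum_w ba aN).
apply: eq_bigr => x _; rewrite [X in _ * (_ * X * _)]ffunE.
by field; rewrite mfact_neq0.
Qed.

Theorem theorem4p4 (R : realFieldType) (d N : nat) (rho : 'I_d -> R)
    (d_gt0 : (0 < d)%N)
    (rho01 : forall i : 'I_d, 0 < rho i < 1)
    (rho_lt1 : \sum_(i < d) rho i < 1)
    (a : 'X_{1..d.+1}) (a_le : (mdeg a <= N)%N) (x : simplexZ d N) :
  krawtchouk rho N a x =
    poch (- N%:R) (mdeg a) * mpow (rho_ext rho) a *
    (\sum_(g : 'X_{1..d.+1 < (mdeg a).+1} | (g <= a)%MM)
       mpoch (mnegr R a) g * (-1) ^+ mdeg g
       / ((mfact g)%:R * poch (- N%:R) (mdeg g) * mpow (rho_ext rho) g)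
       * mmonic R N g x)
  /\
  mmonic R N a x =
    (-1) ^+ mdeg a * poch (- N%:R) (mdeg a) * mpow (rho_ext rho) a *
    (\sum_(b : 'X_{1..d.+1 < (mdeg a).+1} | (b <= a)%MM)
       mpoch (mnegr R a) b
       / ((mfact b)%:R * poch (- N%:R) (mdeg b) * mpow (rho_ext rho) b)
       * krawtchouk rho N b x).
Proof.
set w := rho_ext rho.
have w_neq0 i : w i != 0 by rewrite gt_eqF // rho_ext_gt0.
have krawE b : (mdeg b <= N)%N -> krawtchouk rho N b = kraw N w b.
  move=> bN; apply: (krawtchouk_unique rho01 rho_lt1 (a := b)); first exact: krawtchoukP.
  exact: kraw_is_krawtchouk.
have coefE b (c : R) : mpoch (mnegr R a) b / ((mfact b)%:R * poch (- N%:R) (mdeg b) * mpow w b) * c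
    = (-1) ^+ mdeg b * (mbin a b)%:R * (c / knorm N w b).
  rewrite mpoch_opp_mnm mffact_mbin natrM -[_ * poch _ _ * _]mulrA -/(knorm N w b) invfM.
  by rewrite !mulrA mulfK ?mfact_neq0 // mulrAC.
split.
  rewrite krawE // ffunE; congr (_ * _); apply: eq_bigr => g _.
  rewrite (mulrAC _ ((-1) ^+ _)) -(mulrA _ ((-1) ^+ _)) coefE.
  rewrite -!mulrA !(mulrCA _ ((-1) ^+ _)) signrMK.
  by rewrite [_^-1 * _]mulrC.
(* After normalisation the first formula says that [v] is the binomial transform of [u]. It is
   available at every b below [a], as |b| <= |a| <= N. *)
pose u g := mmonic R N g x / knorm N w g.
pose v b := krawtchouk rho N b x / knorm N w b.
have uE := @mbin_inversion R d.+1 u v a.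
have -> : mmonic R N a x = knorm N w a * u a.
  by rewrite mulrC divfK // knorm_neq0.
rewrite uE => [|b ba].
  rewrite -(mulrA ((-1) ^+ _)) -/(knorm N w a) [(-1) ^+ _ * _]mulrC -[RHS]mulrA.
  congr (_ * _); rewrite mulr_sumr; apply: eq_bigr => b ba.
  (* As |b| <= |a|, the sign (-1)^(|a| - |b|) of the inversion splits as (-1)^|a| (-1)^|b|; the
     second factor is the sign of (-a)_b. *)
  by rewrite coefE -signr_odd oddB ?mnm_le_mdeg // -oddD signr_odd exprD -!mulrA.
have bN := leq_trans (mnm_le_mdeg ba) a_le.
rewrite /v krawE // ffunE mulrC mulKf ?knorm_neq0 //.
by apply: eq_bigr => g _; rewrite /u mulrA mulrAC.
Qed.
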